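(* For any (finite) tree $T$, $\dim(T)=Z(T)$ if and only if $T$ has no interior degree two vertices and every major vertex $v$ of $T$ satisfies $ter(v)\ge 2$.
   Context: $\dim(T)$: metric dimension (minimum size of a set $W$ of vertices such that every pair of distinct vertices has different distance to some vertex of $W$). $Z(T)$: zero forcing number (minimum size of an initial black set such that repeatedly turning black the unique white neighbor of any black vertex with exactly one white neighbor eventually blackens all vertices). A major vertex is a vertex of degree $\ge 3$. An end-vertex (degree-one vertex) $u$ is a terminal vertex of a major vertex $v$ if $d(u,v)<d(u,w)$ for every other major vertex $w$; $ter(v)$ is the number of terminal vertices of $v$. An interior degree two vertex is a vertex of degree $2$ such that the shortest path from it to any terminal vertex includes a major vertex.
   Formalization: The tree is assumed to have at least two vertices (for one vertex dim = 0 but Z = 1), and an interior degree two vertex is required to lie in a tree that has terminal vertices, so degree-two vertices of a path (where dim = Z = 1) are not interior. *)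

(* Defs.v *)
(* A finite simple graph is a symmetric irreflexive relation on a finType *)
From mathcomp Require Import all_boot.
Set Implicit Arguments.
Unset Strict Implicit.
Unset Printing Implicit Defensive.

(* An edge x -- y gives rise to the 2-element ucycle [:: x; y], which is not a
   graph-theoretic cycle; hence the bound 2 in the last clause. *)
Definition is_tree (T : finType) (e : rel T) : Prop :=
  [/\ symmetric e, irreflexive e, 0 < #|T|, forall x y, connect e x y
    & forall c : seq T, ucycle e c -> size c <= 2].

Definition walk (T : finType) (e : rel T) (x y : T) (n : nat) : bool :=
  [exists p : n.-tuple T, path e x p && (last x p == y)].

(* [find] returns the first n < #|T| admitting a walk of length n, and #|T|
   itself when y is not reachable from x. *)
Definition dist (T : finType) (e : rel T) (x y : T) : nat :=
  find (walk e x y) (iota 0 #|T|).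

Definition resolving (T : finType) (e : rel T) (W : {set T}) : bool :=
  [forall x, forall y, (x != y) ==> [exists w in W, dist e x w != dist e y w]].

(* One application of the colour-change rule: some b in B has exactly one white
   neighbour w, and w turns black. *)
Definition forces (T : finType) (e : rel T) (B B' : {set T}) : bool :=
  [exists b in B, exists w,
     ([set x | e b x & x \notin B] == [set w]) && (B' == w |: B)].

Definition zero_forcing (T : finType) (e : rel T) (B : {set T}) : bool :=
  connect (forces e) B setT.

(* The default value of [arg min] is legitimate: these two lemmas show that the
   minima below range over nonempty families. *)
Lemma resolving_setT (T : finType) (e : rel T) : resolving e setT.
Proof.
apply/forallP=> x; apply/forallP=> y; apply/implyP=> xy.
apply/existsP; exists x; rewrite inE /dist /=.
have n0 : 0 < #|T| by apply/card_gt0P; exists x.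
have walk0 a b : walk e a b 0 = (a == b).
  apply/existsP/idP=> [[p]|/eqP->]; first by rewrite tuple0.
  by exists [tuple] => /=.
by case: #|T| n0 => // n _ /=; rewrite !walk0 eqxx [y == x]eq_sym (negbTE xy).
Qed.

Lemma zero_forcing_setT (T : finType) (e : rel T) : zero_forcing e setT.
Proof. exact: connect0. Qed.

Definition metric_dim (T : finType) (e : rel T) : nat :=
  #|[arg min_(W < [set: T] | resolving e W) #|W| ]|.

Definition zero_forcing_number (T : finType) (e : rel T) : nat :=
  #|[arg min_(B < [set: T] | zero_forcing e B) #|B| ]|.

Definition deg (T : finType) (e : rel T) (v : T) : nat := #|[set x | e v x]|.

Definition major (T : finType) (e : rel T) : pred T := fun v => 3 <= deg e v.

Definition terminal_of (T : finType) (e : rel T) (v u : T) : bool :=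
  [&& deg e u == 1, major e v
    & [forall w, major e w && (w != v) ==> (dist e u v < dist e u w)]].

Definition ter (T : finType) (e : rel T) (v : T) : nat :=
  #|[set u | terminal_of e v u]|.

Definition terminal (T : finType) (e : rel T) (u : T) : bool :=
  [exists v, terminal_of e v u].

Definition shortest_path (T : finType) (e : rel T) (x y : T) (p : seq T) : bool :=
  [&& path e x p, last x p == y & size p == dist e x y].

(* The second clause makes explicit that terminal vertices exist; it only matters
   for paths, which have none: degree-two vertices of a path are not interior. *)
Definition interior_deg2 (T : finType) (e : rel T) (v : T) : Prop :=
  [/\ deg e v = 2, exists u, terminal e u
    & forall u p, terminal e u -> shortest_path e v u p -> has (major e) (v :: p)].

(* Main.v *)
(** In a tree, the branches at a vertex [v] are the components left when [v] is
    removed. Two vertices not resolved by [W] have a midpoint at which both of their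
    branches miss [W]; a zero forcing set misses at most one branch at each vertex,
    because a missed branch can only be entered by a force of [v]. Hence zero
    forcing sets are resolving, and [dim <= Z].

    A leg is a branch at a major vertex without major vertices; it is a path with
    exactly one leaf, so [ter v] counts the legs at [v]. A tree with a major vertex
    is resolved by [W] as soon as at most one leg at each vertex misses [W]. If every
    vertex is major or in a leg, and every major vertex has two legs, then the leaves
    of all but one leg per major vertex force the tree, and there are no more of them
    than elements of a resolving set. Conversely, let a zero forcing set [B] be a
    minimum resolving set. Then [B] lies in the legs and misses one leg at each
    vertex having legs, so such a vertex spends its force inside its missed leg.
    Therefore no vertex outside the legs with fewer than two legs can be the first
    of its kind to turn black. *)
Require Import Defs.
From mathcomp Require Import all_boot zify.
Set Implicit Arguments.
Unset Strict Implicit.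
Unset Printing Implicit Defensive.

Local Ltac nat_lia :=
  intros;
  repeat match goal with H : ?P |- _ =>
    lazymatch P with
    | is_true (leq _ _) => fail
    | is_true (negb (leq _ _)) => fail
    | @eq nat _ _ => fail
    | _ => clear H
    end end; lia.

Section TreeMetric.

Variables (T : finType) (e : rel T).
Hypothesis tree_e : is_tree e.

Local Notation d := (dist e).

Let e_sym : symmetric e. Proof. by case: tree_e. Qed.
Let e_irr : irreflexive e. Proof. by case: tree_e. Qed.
Let e_conn x y : connect e x y. Proof. by case: tree_e => _ _ _ H _; apply: H. Qed.
Let e_acyclic c : ucycle e c -> size c <= 2.
Proof. by case: tree_e => _ _ _ _ H; apply: H. Qed.

(** * Distances in a tree *)

Lemma adj_neq x y : e x y -> x != y.
Proof. by apply: contraTneq => ->; rewrite e_irr. Qed.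

Lemma walkP x y n :
  reflect (exists p, [/\ path e x p, last x p = y & size p = n]) (walk e x y n).
Proof.
apply: (iffP existsP) => [[p /andP[ep /eqP lp]]|[p [ep lp /eqP sp]]].
  by exists p; rewrite size_tuple.
by exists (Tuple sp) => /=; rewrite ep lp eqxx.
Qed.

Lemma dist_le_size x p : path e x p -> d x (last x p) <= size p.
Proof.
move=> ep; rewrite leqNgt; apply/negP => lt_p.
have : size p < #|T| by apply: leq_trans lt_p _; rewrite -[#|T|](size_iota 0) find_size.
move=> ltT; have := before_find 0 lt_p; rewrite nth_iota // add0n.
by move/walkP; apply; exists p.
Qed.

(** A connecting walk shortens to one without repetitions, which has fewer than [#|T|] edges; hence
    the search defining [dist] never returns its default. *)
Lemma geodesic x y : exists p, [/\ path e x p, last x p = y & size p = d x y].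
Proof.
have [p ep lp] := connectP (e_conn x y).
case: (shortenP ep) lp => q eq uq _ lp.
have walk_xy : has (walk e x y) (iota 0 #|T|).
  apply/hasP; exists (size q); last by apply/walkP; exists q; rewrite lp.
  by rewrite mem_iota /=; have /card_uniqP := uq; move=> /= <-; rewrite max_card.
have := nth_find 0 walk_xy; rewrite nth_iota ?add0n; first by move/walkP.
by move: walk_xy; rewrite has_find size_iota.
Qed.

Lemma dist_refl x : d x x = 0.
Proof. by apply/eqP; rewrite -leqn0; exact: (@dist_le_size x [::]). Qed.

Lemma dist_triangle y x z : d x z <= d x y + d y z.
Proof.
have [p [ep <- <-]] := geodesic x y; have [q [eq <- <-]] := geodesic (last x p) z.
by rewrite -last_cat -size_cat dist_le_size // cat_path ep.
Qed.

Lemma dist_sym x y : d x y = d y x.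
Proof.
suff le x' y' : d x' y' <= d y' x' by apply/eqP; rewrite eqn_leq !le.
have [p [ep <- <-]] := geodesic y' x'; rewrite -[size p](size_belast y') -size_rev.
have -> : d (last y' p) y' = d (last y' p) (last (last y' p) (rev (belast y' p))).
  by case: (p) => //= a q; rewrite rev_cons last_rcons.
apply: dist_le_size; rewrite rev_path.
by rewrite (eq_path (e' := e)) // => ? ?; rewrite /= e_sym.
Qed.

Lemma dist_eq0 x y : (d x y == 0) = (x == y).
Proof.
apply/eqP/eqP => [d0|->]; last exact: dist_refl.
by have [[|? ?] []] := geodesic x y; rewrite d0 /=.
Qed.

Lemma dist_gt0 x y : (0 < d x y) = (x != y).
Proof. by rewrite lt0n dist_eq0. Qed.

Lemma dist_adj x y : e x y -> d x y = 1.
Proof.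
move=> exy; apply/eqP; rewrite eqn_leq dist_gt0 adj_neq // andbT.
by apply: (@dist_le_size x [:: y]); rewrite /= exy.
Qed.

Lemma dist_adj_le t v a : e v a -> d v t <= (d a t).+1.
Proof. by move=> /dist_adj va; have := dist_triangle a v t; rewrite va. Qed.

Lemma toward v t : v != t -> exists2 a, e v a & d v t = (d a t).+1.
Proof.
rewrite -dist_gt0; have [[|a p] [/= ep lp sp]] := geodesic v t; first by rewrite -sp.
move=> _; case/andP: ep => va ep; exists a => //.
by have := dist_le_size ep; have := dist_adj_le t va; rewrite lp; lia.
Qed.

(* Both [a] and [b] reach [t] through vertices nearer to [t] than [v], so two
   distinct ones would close a cycle through [v]. *)
Lemma toward_uniq t v a b : v != t -> e v a -> e v b ->
  d a t <= d v t -> d b t <= d v t -> a = b.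
Proof.
move=> vt va vb lea leb; pose r := [rel x y | [&& e x y, x != v & y != v]].
have r_sym : connect_sym r.
  by apply: sym_connect_sym => x y /=; rewrite e_sym [(x != v) && _]andbC.
(* Each step towards [t] lands strictly nearer to [t] than [v] is, hence not on [v]. *)
have reach c : e v c -> d c t <= d v t -> connect r c t.
  move=> vc lec; have cv : c != v by rewrite eq_sym adj_neq.
  elim: {c}(d c t) {-2}c (erefl (d c t)) cv lec {vc} => [|n IHn] c dc cv lec.
    by move/eqP: dc; rewrite dist_eq0 => /eqP->.
  have ct : c != t by rewrite -dist_gt0 dc.
  have [c' cc' dc'] := toward ct.
  have c'v : c' != v by apply/eqP => c'v; subst; lia.
  apply: connect_trans (connect1 _) (IHn c' _ _ _) => //=; [|lia|lia].
  by rewrite cc' cv c'v.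
have : connect r a b by apply: connect_trans (reach a va lea) _; rewrite r_sym reach.
case/connectP => p rp lp; case: (shortenP rp) lp => q rq uq _ lq.
have [//|ab] := eqVneq a b.
have vq : v \notin a :: q.
  rewrite inE negb_or adj_neq //=; apply/negP => vq.
  elim: q (a) rq {uq lq} vq => //= x q IH y /andP[/and3P[_ _ xv] rq].
  by rewrite inE eq_sym (negbTE xv) /=; apply: IH rq.
have cyc : ucycle e [:: v, a & q].
  apply/andP; split; last by rewrite cons_uniq vq uq.
  rewrite /= rcons_path -lq [e b v]e_sym va vb andbT /=.
  by apply: sub_path rq => x y /= /and3P[].
have := e_acyclic cyc.
by case: (q) lq => // ba; rewrite ba eqxx in ab.
Qed.

(** * Branches at a vertex *)

Lemma dist_adj_neq t v a : e v a -> d a t != d v t.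
Proof.
move=> va; apply/eqP => dat; have [vt|vt] := eqVneq v t.
  (* Otherwise [a] and a neighbour strictly nearer to [t] are both no farther from [t] than [v], so
     [toward_uniq] identifies them. *)
  by move/eqP: dat; rewrite vt dist_refl dist_eq0 -vt eq_sym (negbTE (adj_neq va)).
have [b vb db] := toward vt.
have ab : a = b by apply: (toward_uniq vt va vb); lia.
by subst; lia.
Qed.

(* For an edge [v a] of the tree: the component of [a] once [v] is removed. *)
Definition branch v a := [set t | d a t < d v t].

Lemma branch_dist v a t : e v a -> t \in branch v a -> d v t = (d a t).+1.
Proof. by move=> /(dist_adj_le t); rewrite inE; lia. Qed.

Lemma branchN_dist v a t : e v a -> t \notin branch v a -> d a t = (d v t).+1.
Proof.
move=> va; have := dist_adj_neq t va; rewrite e_sym in va.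
by have := dist_adj_le t va; rewrite inE; lia.
Qed.

Lemma branch_adj v a : e v a -> a \in branch v a.
Proof. by move=> va; rewrite inE dist_refl dist_gt0 adj_neq. Qed.

Lemma branch_center v a : v \notin branch v a.
Proof. by rewrite inE dist_refl. Qed.

Lemma branch_neq v a t : t \in branch v a -> v != t.
Proof. by apply: contraTneq => <-; apply: branch_center. Qed.

Lemma branch_uniq v a b t :
  e v a -> e v b -> t \in branch v a -> t \in branch v b -> a = b.
Proof.
rewrite !inE => va vb ta tb; apply: (toward_uniq (t := t)) va vb _ _; [|lia|lia].
by rewrite -dist_gt0; lia.
Qed.

Lemma branch_exists v t : v != t -> exists2 a, e v a & t \in branch v a.
Proof. by case/toward => a va dv; exists a; rewrite // inE; lia. Qed.

(** The distances force [y] to be nearer to [v] than [x]. If [x != a], the neighbour of [x] towards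
    [a] is nearer to [v] too, hence equals [y]; but [y] is farther from [a] than [x]. *)
Lemma branch_exit v a x y :
  e v a -> x \in branch v a -> y \notin branch v a -> e x y -> x = a /\ y = v.
Proof.
move=> va xa ya xy; have yx : e y x by rewrite e_sym.
have := (branch_dist va xa, branchN_dist va ya); case=> dx dy.
have := (dist_adj_le v xy, dist_adj_le a yx); case=> lex ley.
rewrite ![d _ v]dist_sym ![d _ a]dist_sym in lex ley.
have [xa0|xNa] := eqVneq x a.
  split=> //; apply/eqP; rewrite -dist_eq0 dist_sym; subst.
  by rewrite dist_refl in dx ley; lia.
have [x' xx' dx'] := toward xNa.
have va' := dist_adj_le x' va.
have x'y : x' = y.
  apply: (toward_uniq (t := v)) xx' xy _ _; rewrite ?dist_gt0.
  - by rewrite -dist_gt0 dist_sym; lia.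
  - by rewrite ![d _ v]dist_sym; rewrite ![d _ a]dist_sym in dx'; lia.
  - by rewrite ![d _ v]dist_sym; lia.
by subst; rewrite ![d _ a]dist_sym in dx'; lia.
Qed.

(** A geodesic from [x] to [w] can leave the branch only along the edge from [a] to [v]. *)
Lemma branch_cut v a x w : e v a -> x \in branch v a -> w \notin branch v a ->
  d x w = d x v + d v w.
Proof.
move=> va xa wa; apply/eqP; rewrite eqn_leq dist_triangle /=.
elim: {x}(d x w) {-2}x (erefl (d x w)) xa => [|n IHn] x dx xa.
  by move/eqP: dx wa; rewrite dist_eq0 => /eqP<-; rewrite xa.
have xw : x != w by rewrite -dist_gt0 dx.
have [y xy dy] := toward xw; have dxv := dist_adj_le v xy.
have [ya|yNa] := boolP (y \in branch v a); first by have := IHn y _ ya; lia.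
by have [? ?] := branch_exit va xa yNa xy; subst; rewrite dist_refl in dxv; nat_lia.
Qed.

Lemma branch_cutC v a x w : e v a -> x \in branch v a -> w \notin branch v a ->
  d w x = d w v + d v x.
Proof.
move=> va xa wa; rewrite dist_sym (branch_cut va xa wa) addnC.
by rewrite [d v w]dist_sym [d x v]dist_sym.
Qed.

(** The detour through [v] uses the edge [v a] twice. *)
Lemma dist_in_branch v a x y : e v a -> x \in branch v a -> y \in branch v a ->
  d x y + 2 <= d x v + d v y.
Proof.
move=> va xa ya; have := dist_triangle a x y.
rewrite [d x v]dist_sym [d x a]dist_sym.
by rewrite (branch_dist va xa) (branch_dist va ya); nat_lia.
Qed.

(** * Resolving sets and missed branches *)

(** Trees are bipartite: every edge changes the distance to [w] by exactly one. *)
Lemma odd_dist x p w :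
  path e x p -> odd (d (last x p) w) = odd (d x w) (+) odd (size p).
Proof.
elim: p x => [|y p IHp] x /=; first by rewrite addbF.
case/andP => xy /IHp ->; have [yw|yw] := boolP (w \in branch x y).
  by rewrite (branch_dist xy yw) /= addbN addNb negbK.
by rewrite (branchN_dist xy yw) /= addbN addNb.
Qed.

Lemma equidistant_midpoint x y w : x != y -> d x w = d y w ->
  exists m a b, [/\ e m a, e m b, a != b, x \in branch m a & y \in branch m b]
    /\ d m x = d m y.
Proof.
move=> xy dxy; have [p [ep lp sp]] := geodesic x y.
(* Equal distances to [w] make the geodesic from [x] to [y] even, so it has a middle vertex. *)
have := odd_dist w ep; rewrite lp dxy => /(congr1 (addb (odd (d y w)))).
rewrite addbA addbb addFb => /esym p_even.
pose j := (size p)./2.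
have j2 : size p = j + j.
  by rewrite addnn -{1}(odd_double_half (size p)) p_even.
have ejl : path e x (take j p) && path e (last x (take j p)) (drop j p).
  by rewrite -cat_path cat_take_drop.
case/andP: ejl => /dist_le_size le1 /dist_le_size.
rewrite -last_cat cat_take_drop lp; move: le1.
set m := last _ _; rewrite size_drop size_takel; last by rewrite j2; nat_lia.
move=> le1 le2; have := dist_triangle m x y; rewrite -sp j2 => tri.
have j_gt0 : 0 < j by move: xy; rewrite -dist_gt0 -sp j2; nat_lia.
have dmx : d m x = j by rewrite dist_sym; nat_lia.
have dmy : d m y = j by nat_lia.
have mx : m != x by rewrite -dist_gt0 dmx.
have my : m != y by rewrite -dist_gt0 dmy.
have [[a ma dax] [b mb dby]] := (toward mx, toward my).
exists m, a, b; split; last by rewrite dmx dmy.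
split; rewrite // ?inE; [|nat_lia|nat_lia].
apply/eqP => ab; subst b; have := dist_triangle a x y.
by rewrite [d x a]dist_sym; nat_lia.
Qed.

Definition hits (W : {set T}) v a := [exists w in W, w \in branch v a].

(** An element of [W] gives the unresolved pair a midpoint by parity. One lying in the branch of [x]
    there would be nearer to [x] than to [y], and symmetrically. *)
Lemma unresolved_branches (W : {set T}) : W != set0 -> ~~ resolving e W ->
  exists m a b, [/\ e m a, e m b, a != b, ~~ hits W m a & ~~ hits W m b].
Proof.
case/set0Pn => w0 w0W /forallPn[x /forallPn[y]]; rewrite negb_imply negb_exists_in.
case/andP => xy /forall_inP unres.
have eqd w : w \in W -> d x w = d y w by move/unres; rewrite negbK => /eqP.
have [m [a [b [[ma mb ab xa yb] dm]]]] := equidistant_midpoint xy (eqd _ w0W).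
exists m, a, b; split=> //; apply/exists_inP => -[w wW wm].
  have wb : w \notin branch m b.
    by apply: contra ab => wb; rewrite (branch_uniq ma mb wm wb).
  have := branch_cut mb yb wb; have := dist_in_branch ma xa wm.
  by rewrite (eqd w wW) ![d _ m]dist_sym; nat_lia.
have wa : w \notin branch m a.
  by apply: contra ab => wa; rewrite (branch_uniq ma mb wa wm).
have := branch_cut ma xa wa; have := dist_in_branch mb yb wm.
by rewrite (eqd w wW) ![d _ m]dist_sym; nat_lia.
Qed.

(** Seen from outside both branches, [a] and [b] are each one step beyond [v]. *)
Lemma resolving_hits (W : {set T}) v a b : resolving e W -> e v a -> e v b ->
  ~~ hits W v a -> ~~ hits W v b -> a = b.
Proof.
move=> /forallP/(_ a)/forallP/(_ b)/implyP res va vb.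
rewrite /hits !negb_exists_in => /forall_inP na /forall_inP nb.
apply/eqP; apply: contraT => /res/exists_inP[w wW].
by rewrite (branchN_dist va (na w wW)) (branchN_dist vb (nb w wW)) eqxx.
Qed.

(** * Zero forcing sets and missed branches *)

(** The step keeps both colourings reachable from [B], so that [forced_branch_entry] applies to
    them. *)
Lemma forcing_ind (P : {set T} -> Prop) (B C : {set T}) :
  P B ->
  (forall (D : {set T}) b w,
     connect (forces e) B D -> connect (forces e) B (w |: D) -> P D -> b \in D ->
     e b w -> (forall x, e b x -> x \notin D -> x = w) -> P (w |: D)) ->
  connect (forces e) B C -> P C.
Proof.
move=> PB step /connectP[p + ->]; elim/last_ind: p => //= p C' IHp.
rewrite rcons_path last_rcons => /andP[fp fC'].
have BD : connect (forces e) B (last B p) by apply/connectP; exists p.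
have BC' := connect_trans BD (connect1 fC').
case/exists_inP: fC' => b bD /existsP[w /andP[/eqP white /eqP C'E]].
have := set11 w; rewrite -white inE => /andP[bw _].
rewrite C'E in BC' *; apply: (step _ b) => // [|x bx xB]; first exact: IHp.
by apply/set1P; rewrite -white inE bx.
Qed.

(** A largest colouring reachable from [B] admits no further force. *)
Lemma zero_forcing_of_stalled (B : {set T}) :
  (forall C : {set T}, B \subset C ->
     (forall b w, b \in C -> e b w -> w \notin C ->
        exists x, [/\ e b x, x \notin C & x != w]) -> C = setT) ->
  zero_forcing e B.
Proof.
move=> stalled; pose P := [pred C : {set T} | connect (forces e) B C].
have PB : P B by exact: connect0.
case: (arg_maxnP (fun C : {set T} => #|C|) PB) => C BC Cmax.
rewrite /zero_forcing -(stalled C) //.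
  apply: (forcing_ind (P := fun C => is_true (B \subset C))) BC => //.
  by move=> D b w _ _ BD _ _ _; apply: subset_trans BD (subsetUr _ _).
move=> b w bC bw wC.
case: (pickP [pred x | [&& e b x, x \notin C & x != w]]) => [x /and3P[]|none].
  by exists x.
have /Cmax : P (w |: C).
  apply: connect_trans BC (connect1 _); apply/exists_inP; exists b => //.
  apply/existsP; exists w; rewrite eqxx andbT; apply/eqP/setP => x.
  rewrite !inE; have [->|xw] := eqVneq x w; first by rewrite bw wC.
  by have /= := none x; rewrite xw andbT.
by rewrite cardsU1 wC /=; nat_lia.
Qed.

(* The only way into a branch is through its root, which then has a single
   white neighbour left. *)
Lemma forced_branch_entry (B C : {set T}) v a x :
  e v a -> ~~ hits B v a -> connect (forces e) B C ->
  x \in C -> x \in branch v a -> v \in C /\ forall y, e v y -> y \in C.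
Proof.
move=> va nB BC; move: x.
apply: (forcing_ind (P := fun C : {set T} => forall x, x \in C -> x \in branch v a ->
    v \in C /\ forall y, e v y -> y \in C)) BC => [x xB xa|D b w _ _ IH bD bw uniq_w x].
  by case/exists_inP: nB; exists x.
have [/existsP[y /andP[yD ya]] _ _|nD] := boolP [exists y in D, y \in branch v a].
  by have [vD nbrs] := IH y yD ya; split=> [|z /nbrs zD]; rewrite inE ?vD ?zD orbT.
rewrite in_setU1 => /orP[/eqP-> wa|xD xa]; last by case/exists_inP: nD; exists x.
have ba : b \notin branch v a by apply: contra nD => ba; apply/exists_inP; exists b.
rewrite e_sym in bw; have [_ bv] := branch_exit va wa ba bw; subst b.
split=> [|y vy]; first by rewrite inE bD orbT.
rewrite in_setU1.
by case: (boolP (y \in D)) => [|/(uniq_w y vy) ->]; rewrite ?orbT ?eqxx.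
Qed.

(** Both roots stay white: by [forced_branch_entry], once one is black all neighbours of [v] are,
    including the other. *)
Lemma zero_forcing_hits (B : {set T}) v a b : zero_forcing e B ->
  e v a -> e v b -> ~~ hits B v a -> ~~ hits B v b -> a = b.
Proof.
move=> zfB va vb na nb; apply/eqP; apply: contraT => ab.
suff : a \notin [set: T] /\ b \notin [set: T] by rewrite !inE; case.
apply: (forcing_ind (P := fun C => a \notin C /\ b \notin C)) zfB.
  by split; [move: na | move: nb]; apply: contra => xB; apply/exists_inP;
     [exists a | exists b] => //; apply: branch_adj.
move=> D c w _ BwD [aD bD] cD cw uniq_w; have entry := forced_branch_entry _ _ BwD.
have entry_a := entry _ _ a va na _ (branch_adj va).
have entry_b := entry _ _ b vb nb _ (branch_adj vb).
move: entry_a entry_b; rewrite !in_setU1 (negbTE aD) (negbTE bD) !orbF.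
have [aw|aw] := eqVneq a w; have [bw|bw] := eqVneq b w => //=.
- by rewrite aw bw eqxx in ab.
- by move=> /(_ isT)[_ /(_ b vb)]; rewrite !inE (negbTE bD) (negbTE bw).
- by move=> _ /(_ isT)[_ /(_ a va)]; rewrite !inE (negbTE aD) (negbTE aw).
Qed.

Lemma zero_forcing_neq0 (B : {set T}) : zero_forcing e B -> B != set0.
Proof.
move=> zfB; have [_ _ /card_gt0P[x _] _ _] := tree_e; apply/negP => /eqP B0.
suff : [set: T] = set0 by move/setP/(_ x); rewrite !inE.
by apply: (forcing_ind (P := fun C => C = set0)) zfB => // D b w _ _ ->; rewrite inE.
Qed.

Lemma zero_forcing_resolving (B : {set T}) : zero_forcing e B -> resolving e B.
Proof.
move=> zfB; apply: contraT => /(unresolved_branches (zero_forcing_neq0 zfB)).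
case=> m [a [b [ma mb /eqP ab na nb]]]; case: ab.
exact: zero_forcing_hits zfB ma mb na nb.
Qed.

(** * Legs and terminal vertices *)

Lemma major_of_nbrs v a b c :
  e v a -> e v b -> e v c -> a != b -> a != c -> b != c -> major e v.
Proof.
move=> va vb vc ab ac bc; rewrite /major /deg.
have sub : [set a; b; c] \subset [set x | e v x].
  by apply/subsetP => x; rewrite !inE => /orP[/orP[]|] /eqP->.
apply: leq_trans (subset_leq_card sub).
by rewrite setUC cardsU1 cards2 !inE ab negb_or ![c == _]eq_sym ac bc.
Qed.

Lemma major_two_nbrs v c : major e v ->
  exists a b, [/\ e v a, e v b, a != b, a != c & b != c].
Proof.
rewrite /major /deg (cardsD1 c) => le3.
have : 1 < #|[set x | e v x] :\ c| by case: (c \in _) le3; nat_lia.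
case/card_gt1P => a [b []]; rewrite !inE => /andP[ac va] /andP[bc vb] ab.
by exists a, b.
Qed.

Lemma leaf_nbr_uniq u a b : deg e u = 1 -> e u a -> e u b -> a = b.
Proof.
move/eqP/cards1P => [c /setP Nu] ua ub.
by move: (Nu a) (Nu b); rewrite !inE ua ub => /esym/eqP-> /esym/eqP->.
Qed.

Lemma leaf_not_major u : deg e u = 1 -> ~~ major e u.
Proof. by rewrite /major => ->. Qed.

(** Geodesics from [m] to [t] pass [w]. Were [t] outside the branch of [w] at [m], those from [w] to
    [t] would pass [m], forcing [m = w]. *)
Lemma beyond_dist m a w c t : e m a -> w \in branch m a -> e w c ->
  m \notin branch w c -> t \in branch w c ->
  t \in branch m a /\ d m t = d m w + d w t.
Proof.
move=> ma wa wc mc tc; have dtm := branch_cutC wc tc mc; split=> //.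
apply: contraT => ta; have := branch_cut ma wa ta.
have := branch_neq wa; rewrite -dist_gt0.
by rewrite [d w m]dist_sym; nat_lia.
Qed.

(** A vertex of the branch farthest from [v] has no neighbour beyond it. *)
Lemma branch_has_leaf v a : e v a -> exists2 u, deg e u = 1 & u \in branch v a.
Proof.
move=> va; case: (arg_maxnP (d v) (branch_adj va)) => u ua umax; exists u => //.
have uv : u != v by rewrite eq_sym (branch_neq ua).
have [c uc vc] := branch_exists uv; apply/eqP/cards1P; exists c.
apply/setP => x; rewrite !inE; apply/idP/eqP => [ux|->//].
apply/eqP; apply: contraT => xc.
have vx : v \notin branch u x.
  by apply: contra xc => vx; rewrite (branch_uniq ux uc vx vc).
have [/umax + dx] := beyond_dist va ua ux vx (branch_adj ux).
by rewrite /= dx (dist_adj ux); nat_lia.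
Qed.

Definition leg v a :=
  [&& major e v, e v a & [forall t in branch v a, ~~ major e t]].

Lemma legP v a : reflect [/\ major e v, e v a &
    forall t, t \in branch v a -> ~~ major e t] (leg v a).
Proof.
by apply: (iffP and3P) => [[? ? /forall_inP]|[? ? H]]; split=> //; apply/forall_inP.
Qed.

Lemma leg_majorN v a t : leg v a -> major e t -> t \notin branch v a.
Proof. by case/legP => _ _ H; apply: contraTN => /H. Qed.

(** Each centre is major, so it lies outside the other leg; each would then separate [x] from the
    other, which forces their distance to be zero. *)
Lemma leg_inj v a v' a' x : leg v a -> leg v' a' ->
  x \in branch v a -> x \in branch v' a' -> v = v' /\ a = a'.
Proof.
move=> l l' xa xa'; have [[mv va _] [mv' va' _]] := (legP _ _ l, legP _ _ l').
have := branch_cut va xa (leg_majorN l mv').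
have := branch_cut va' xa' (leg_majorN l' mv); rewrite [d v' v]dist_sym => dx' dx.
have vv : v = v' by apply/eqP; rewrite -dist_eq0; apply/eqP; nat_lia.
by subst; split=> //; apply: branch_uniq va va' xa xa'.
Qed.

(** At a major vertex of the branch farthest from [m], all branches but the one towards [m] are
    legs. *)
Lemma major_branch_two_legs m a t : e m a -> t \in branch m a -> major e t ->
  exists w c1 c2, [/\ leg w c1, leg w c2, c1 != c2,
    branch w c1 \subset branch m a & branch w c2 \subset branch m a].
Proof.
move=> ma ta mt; pose P := [pred t | (t \in branch m a) && major e t].
have Pt : P t by rewrite /= ta.
case: (arg_maxnP (d m) Pt) => w /= /andP[wa mw] wmax.
have wm : w != m by rewrite eq_sym (branch_neq wa).
have [c wc mc] := branch_exists wm.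
have [c1 [c2 [w1 w2 c12 c1c c2c]]] := major_two_nbrs c mw.
have beyond c' : e w c' -> c' != c -> leg w c' /\ branch w c' \subset branch m a.
  move=> wc' c'c; have mc' : m \notin branch w c'.
    by apply: contra c'c => mc'; rewrite (branch_uniq wc' wc mc' mc).
  split; last by apply/subsetP => x /(beyond_dist ma wa wc' mc')[].
  apply/legP; split=> // x xc'; have [xa dx] := beyond_dist ma wa wc' mc' xc'.
  apply/negP => mx; have := wmax x; rewrite xa mx => /(_ isT).
  have := branch_neq xc'; rewrite -dist_gt0.
  by rewrite /= dx; nat_lia.
have [[l1 s1] [l2 s2]] := (beyond _ w1 c1c, beyond _ w2 c2c).
by exists w, c1, c2.
Qed.

Lemma hitsS (W : {set T}) v a v' a' :
  branch v a \subset branch v' a' -> hits W v a -> hits W v' a'.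
Proof. by move/subsetP=> sub /exists_inP[w wW /sub wa]; apply/exists_inP; exists w. Qed.

Lemma leg_criterion (W : {set T}) : (exists v, major e v) ->
  (forall v a b, leg v a -> leg v b -> ~~ hits W v a -> ~~ hits W v b -> a = b) ->
  resolving e W.
Proof.
move=> [v0 mv0] legW.
have branch_hit m a t : e m a -> t \in branch m a -> major e t -> hits W m a.
  move=> ma ta mt.
  have [w [c1 [c2 [l1 l2 c12 s1 s2]]]] := major_branch_two_legs ma ta mt.
  apply: contraT => nW; case/eqP: c12.
  by apply: legW l1 l2 _ _; apply: contra nW; apply: hitsS.
have missed_leg m a : major e m -> e m a -> ~~ hits W m a -> leg m a.
  move=> mm ma na; apply/legP; split=> // t ta; apply: contra na; exact: branch_hit.
have W0 : W != set0.
  have [a [b [va vb ab _ _]]] := major_two_nbrs v0 mv0.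
  have [/exists_inP[w wW _]|na] := boolP (hits W v0 a); first by apply/set0Pn; exists w.
  have [/exists_inP[w wW _]|nb] := boolP (hits W v0 b); first by apply/set0Pn; exists w.
  by case/eqP: ab; apply: (legW v0) => //; apply: missed_leg.
apply: contraT => /(unresolved_branches W0)[m [a [b [ma mb ab na nb]]]].
(* The missed branches do not contain [v0], so the branch towards [v0] is a third one at [m]. *)
have mm : major e m.
  have [->//|mv] := eqVneq m v0; have [c mc vc] := branch_exists mv.
  apply: (major_of_nbrs ma mb mc ab); [apply: contraNneq na | apply: contraNneq nb];
    by move=> ->; apply: branch_hit vc mv0.
by case/eqP: ab; apply: (legW m) => //; apply: missed_leg.
Qed.

(** A leg is a path. The midpoint of two such vertices would lie in the leg with [v] in a third
    branch, hence be major. *)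
Lemma leg_dist_inj v a x y : leg v a -> x \in branch v a -> y \in branch v a ->
  d x v = d y v -> x = y.
Proof.
case/legP => mv va free xa ya dxy; apply/eqP; apply: contraT => xy.
have [m [b [c [[mb mc bc xb yc] dm]]]] := equidistant_midpoint xy dxy.
have vb : v \notin branch m b.
  apply/negP => vb; have := dist_in_branch mb xb vb.
  have vc : v \notin branch m c.
    by apply: contra bc => vc; rewrite (branch_uniq mb mc vb vc).
  by have := branch_cut mc yc vc; rewrite ![d _ m]dist_sym; nat_lia.
have vc : v \notin branch m c.
  apply/negP => vc; have := dist_in_branch mc yc vc.
  by have := branch_cut mb xb vb; rewrite ![d _ m]dist_sym; nat_lia.
have mv' : m != v.
  apply: contra bc => /eqP m_v; subst m.
  by rewrite -(branch_uniq va mb xa xb) -(branch_uniq va mc ya yc).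
have ma : m \in branch v a.
  apply: contraT => mNa; have := branch_cut va xa mNa; have := branch_cut mb xb vb.
  by move: mv'; rewrite -dist_gt0 [d v m]dist_sym; nat_lia.
have [f mf vf] := branch_exists mv'.
have := free m ma; rewrite (major_of_nbrs mb mc mf bc) //.
  by apply: contraNneq vb => ->.
by apply: contraNneq vc => ->.
Qed.

(** By [leg_dist_inj] the geodesic from the farther leaf to [v] passes the nearer one, which then
    has a neighbour on either side. *)
Lemma leg_leaf_uniq v a u u' : leg v a -> u \in branch v a -> u' \in branch v a ->
  deg e u = 1 -> deg e u' = 1 -> u = u'.
Proof.
move=> l; wlog le : u u' / d u v <= d u' v.
  move=> H ua u'a du du'; case: (leqP (d u v) (d u' v)) => [|/ltnW] le; first exact: H.
  by apply/esym; apply: H.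
move=> ua u'a du du'; have [mv va free] := legP _ _ l.
apply/eqP; apply: contraT => uu'.
have [p [ep lp sp]] := geodesic u' v.
(* After [j] steps the geodesic is as far from [v] as [u]. *)
pose j := d u' v - d u v; have jp : j <= size p by rewrite sp leq_subr.
have /andP[] : path e u' (take j p) && path e (last u' (take j p)) (drop j p).
  by rewrite -cat_path cat_take_drop.
move=> /dist_le_size le1 /dist_le_size; rewrite -last_cat cat_take_drop lp; move: le1.
set z := last _ _; rewrite size_drop size_takel // sp => le1 le2.
have := dist_triangle z u' v; rewrite /j in le1 le2 * => tri.
have uv : u != v by rewrite eq_sym (branch_neq ua).
have zu : z = u.
  apply: (leg_dist_inj l) => //; last by nat_lia.
  apply: contraT => za; have := branch_cut va u'a za.
  by move: uv; rewrite -dist_gt0; nat_lia.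
rewrite zu in tri le1.
have [[b ub db] [c uc dc]] := (toward uu', toward uv).
have bc := leaf_nbr_uniq du ub uc; subst c; have := dist_triangle b u' v.
by rewrite [d u' b]dist_sym; rewrite [d u' u]dist_sym in le1 tri; nat_lia.
Qed.

(** Take a largest branch containing [u] and no major vertex. If its centre [y] is not major, moving
    the cut one edge towards [v0] absorbs [y] and gives a larger one. *)
Lemma leaf_in_leg u : (exists v, major e v) -> deg e u = 1 ->
  exists v a, leg v a /\ u \in branch v a.
Proof.
move=> [v0 mv0] du.
have uv0 : u != v0 by apply: contraTneq mv0 => <-; apply: leaf_not_major.
have [y0 uy0 _] := branch_exists uv0.
pose P := [pred p : T * T | [&& e p.1 p.2, u \in branch p.1 p.2 &
             [forall t in branch p.1 p.2, ~~ major e t]]].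
(* This branch is [u] alone. *)
have Py0 : P (y0, u).
  have y0u : e y0 u by rewrite e_sym.
  rewrite /= y0u branch_adj //=; apply/forall_inP => t tu.
  have [<-|ut] := eqVneq u t; first exact: leaf_not_major.
  have [c uc tc] := branch_exists ut; rewrite (leaf_nbr_uniq du uc uy0) in tc.
  by move: tc tu; rewrite !inE; nat_lia.
case: (arg_maxnP (fun p : T * T => #|branch p.1 p.2|) Py0) => -[y x] /=.
case/and3P => yx ux /forall_inP free maxyx; exists y, x; split=> //.
apply/legP; split=> //; apply: contraT => my.
have yv0 : y != v0 by apply: contraNneq my => ->.
have [z yz vz] := branch_exists yv0.
have zx : z != x by apply: contraTneq vz => ->; apply/negP => /free; rewrite mv0.
have zy : e z y by rewrite e_sym.
have sub : y |: branch y x \subset branch z y.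
  apply/subsetP => t; rewrite in_setU1 => /orP[/eqP->|tx]; first exact: branch_adj.
  apply: contraT => tz; have tz' : t \in branch y z.
    by have := branchN_dist zy tz; rewrite inE; nat_lia.
  by rewrite (branch_uniq yz yx tz' tx) eqxx in zx.
have := maxyx (z, y); rewrite /= zy (subsetP sub) /=; last by rewrite in_setU1 ux orbT.
have -> : [forall t in branch z y, ~~ major e t].
  apply/forall_inP => t tz; have [<-//|yt] := eqVneq y t.
  have [c yc tc] := branch_exists yt.
  have cz : c != z.
    by apply: contraTneq tc => ->; move: tz; rewrite !inE; nat_lia.
  have [cx|cx] := eqVneq c x; first by apply: free; rewrite -cx.
  by case/negP: my; apply: major_of_nbrs yc yz yx _ _ _.
move=> /(_ isT); have := subset_leq_card sub; rewrite /= cardsU1 branch_center; nat_lia.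
Qed.

(** Geodesics from a leaf to any other major vertex pass the centre of its leg, which is therefore
    the nearest. *)
Lemma terminalP v u : reflect
  (deg e u = 1 /\ exists a, leg v a /\ u \in branch v a) (terminal_of e v u).
Proof.
apply: (iffP and3P) => [[/eqP du mv /forallP near]|[du [a [l ua]]]].
  split=> //; have [w [b [l ub]]] := leaf_in_leg (ex_intro _ v mv) du.
  have [mw wb _] := legP _ _ l; exists b.
  have [<-//|wv] := eqVneq w v; have := near w; rewrite mw wv /=.
  by have := branch_cut wb ub (leg_majorN l mv); nat_lia.
have [mv va _] := legP _ _ l; rewrite du; split=> //.
apply/forallP => w; apply/implyP => /andP[mw wv].
by move: wv; rewrite (branch_cut va ua (leg_majorN l mw)) eq_sym -dist_gt0; nat_lia.
Qed.

Lemma ter_ge2P v :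
  reflect (exists a b, [/\ leg v a, leg v b & a != b]) (2 <= ter e v).
Proof.
apply: (iffP card_gt1P) => [[u [u' []]]|[a [b [la lb ab]]]].
  rewrite !inE => /terminalP[du [a [la ua]]] /terminalP[du' [b [lb ub]]] uu'.
  exists a, b; split=> //; apply: contra uu' => /eqP ab; subst b.
  by rewrite (leg_leaf_uniq la ua ub).
have [[_ va _] [_ vb _]] := (legP _ _ la, legP _ _ lb).
have [[u du ua] [u' du' ub]] := (branch_has_leaf va, branch_has_leaf vb).
exists u, u'; split; rewrite ?inE.
- by apply/terminalP; split=> //; exists a.
- by apply/terminalP; split=> //; exists b.
- by apply: contra ab => /eqP uu'; subst u'; rewrite (branch_uniq va vb ua ub).
Qed.

Lemma path_into_branch w b x p : e w b -> x \notin branch w b -> path e x p ->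
  last x p \in branch w b -> w \in x :: p.
Proof.
move=> wb; elim: p x => [|y p IHp] x xb /=; first by rewrite (negbTE xb).
case/andP => xy ep lb; have [yb|yb] := boolP (y \in branch w b).
  rewrite e_sym in xy; have [_ ->] := branch_exit wb yb xb xy; exact: mem_head.
by rewrite in_cons (IHp y) ?orbT.
Qed.

Definition in_leg z := [exists v, exists a, leg v a && (z \in branch v a)].

Lemma in_legP z : reflect (exists v a, leg v a /\ z \in branch v a) (in_leg z).
Proof.
apply: (iffP existsP) => [[v /existsP[a /andP[]]]|[v [a [l za]]]]; first by exists v, a.
by exists v; apply/existsP; exists a; rewrite l.
Qed.

(** From outside the legs, a terminal vertex is reached only through the major centre of its leg.
    From inside a leg, the geodesic to the leaf of that leg meets no major vertex. *)
Lemma interior_deg2P v : (exists u, terminal e u) ->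
  deg e v = 2 -> ~ interior_deg2 e v <-> in_leg v.
Proof.
move=> [u0 ter_u0] dv; split=> [not_int|/in_legP[w [b [l vb]]] [_ _ int]].
  apply: contraT => not_leg; case: not_int; split=> // [|u p /existsP[w]].
    by exists u0.
  case/terminalP => _ [b [l ub]] /and3P[ep /eqP lp _].
  have [mw wb _] := legP _ _ l; apply/hasP; exists w => //.
  apply: path_into_branch wb _ ep _; last by rewrite lp.
  by apply: contra not_leg => vb; apply/in_legP; exists w, b.
have [mw wb _] := legP _ _ l; have [u du ub] := branch_has_leaf wb.
have [p [ep lp sp]] := geodesic v u.
have tu : terminal e u.
  by apply/existsP; exists w; apply/terminalP; split=> //; exists b.
(* A major [t] on the geodesic is outside the leg, so both halves pass through [w], which is too
   long. *)
have := int u p tu; rewrite /shortest_path ep lp sp !eqxx => /(_ isT)/hasP[t tp mt].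
have tb := leg_majorN l mt; have := (branch_cut wb vb tb, branch_cutC wb ub tb).
case=> dvt dtu; have := dist_in_branch wb vb ub.
case/splitPl: tp ep lp sp => p1 p2 lp1; rewrite cat_path last_cat lp1 size_cat.
case/andP => /dist_le_size; rewrite lp1 => le1 /dist_le_size le2 lp2.
by rewrite lp2 in le2; rewrite [d t w]dist_sym in dtu; nat_lia.
Qed.

(** * Comparing the two minima *)

Lemma metric_dim_min (W : {set T}) : resolving e W -> metric_dim e <= #|W|.
Proof.
by rewrite /metric_dim; case: arg_minnP => [|W0 _ H /H]; rewrite ?resolving_setT.
Qed.

Lemma metric_dim_ex : exists2 W : {set T}, resolving e W & #|W| = metric_dim e.
Proof.
by rewrite /metric_dim; case: arg_minnP => [|W0]; rewrite ?resolving_setT //; exists W0.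
Qed.

Lemma zero_forcing_number_min (B : {set T}) :
  zero_forcing e B -> zero_forcing_number e <= #|B|.
Proof.
rewrite /zero_forcing_number; case: arg_minnP => [|B0 _ H /H //].
exact: zero_forcing_setT.
Qed.

Lemma zero_forcing_number_ex :
  exists2 B : {set T}, zero_forcing e B & #|B| = zero_forcing_number e.
Proof.
rewrite /zero_forcing_number; case: arg_minnP => [|B0]; last by exists B0.
exact: zero_forcing_setT.
Qed.

Lemma metric_dim_le_zero_forcing_number : metric_dim e <= zero_forcing_number e.
Proof.
have [B zfB <-] := zero_forcing_number_ex.
exact/metric_dim_min/zero_forcing_resolving.
Qed.

(** * Necessity of the conditions *)

Lemma hitsD1 (B : {set T}) z v a :
  z \notin branch v a -> hits B v a -> hits (B :\ z) v a.
Proof.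
move=> za /exists_inP[w wB wa]; apply/exists_inP; exists w => //.
by rewrite !inE wB andbT; apply: contraNneq za => <-.
Qed.

(* Minimality of [B] puts it inside the legs and makes it miss a leg at every
   vertex having one, so a vertex with two legs spends its only force there and
   cannot force a vertex violating the conclusion. *)
Lemma leg_or_two_legs (B : {set T}) z : (exists v, major e v) ->
  zero_forcing e B -> (forall W : {set T}, resolving e W -> #|B| <= #|W|) ->
  in_leg z \/ exists a b, [/\ leg z a, leg z b & a != b].
Proof.
move=> has_major zfB minB.
have legB v a b : leg v a -> leg v b -> ~~ hits B v a -> ~~ hits B v b -> a = b.
  by move=> /legP[_ va _] /legP[_ vb _]; exact: zero_forcing_hits.
have remove x : x \in B -> ~ (forall v a b, leg v a -> leg v b ->
    ~~ hits (B :\ x) v a -> ~~ hits (B :\ x) v b -> a = b).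
  move=> xB /(leg_criterion has_major)/minB; rewrite (cardsD1 x) xB; nat_lia.
have B_in_leg x : x \in B -> in_leg x.
  move=> xB; apply: contraT => x_out; case: (remove x xB) => v a b la lb na nb.
  by apply: (legB v) => //; [apply: contra na | apply: contra nb]; apply: hitsD1;
    apply: contra x_out => xv; apply/in_legP; exists v; [exists a | exists b].
(* If [B] met every leg at [v], an element in one of them could be removed: only its own leg would
   become missed. *)
have missed v a : leg v a -> exists2 a', leg v a' & ~~ hits B v a'.
  move=> l; case: (pickP [pred c | leg v c && ~~ hits B v c]) => [c /andP[]|none].
    by exists c.
  have hit c : leg v c -> hits B v c.
    by move=> lc; have /= := none c; rewrite lc /= => /negbFE.
  have /exists_inP[x xB xa] := hit a l; case: (remove x xB) => w b c lb lc nb nc.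
  have [xb|xb] := boolP (x \in branch w b); last first.
    have [xc|xc] := boolP (x \in branch w c); last first.
      by apply: (legB w) => //; [apply: contra nb | apply: contra nc]; apply: hitsD1.
    have [vw ac] := leg_inj l lc xa xc; subst w c.
    by case/negP: nb; apply: hitsD1 xb (hit _ lb).
  have [vw ab] := leg_inj l lb xa xb; subst w b.
  have [xc|xc] := boolP (x \in branch v c); first by have [] := leg_inj l lc xa xc.
  by case/negP: nc; apply: hitsD1 xc (hit _ lc).
pose two_legs x := [exists a, exists b, [&& leg x a, leg x b & a != b]].
suff /(_ z (in_setT z))/orP[|/existsP[a /existsP[b /and3P[]]]] :
    forall x, x \in [set: T] -> in_leg x || two_legs x.
- by left.
- by right; exists a, b.
apply: (forcing_ind (P := fun C : {set T} =>
  forall x, x \in C -> in_leg x || two_legs x)) zfB => [x /B_in_leg->//|].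
move=> D b w BD _ IH bD bw uniq_w x; rewrite in_setU1 => /orP[/eqP->|]; last exact: IH.
apply: contraT; rewrite negb_or => /andP[w_out w_two].
have [wD|wD] := boolP (w \in D); first have := IH w wD.
  by rewrite (negbTE w_out) (negbTE w_two).
(* If [b] is in a leg, [w] is its centre. That leg is the only one there, hence the missed one, and
   was entered only after [w] was black. *)
have [/in_legP[v [a [l ba]]]|b_out] := boolP (in_leg b).
  have [_ va _] := legP _ _ l.
  have wa : w \notin branch v a.
    by apply: contra w_out => wa; apply/in_legP; exists v, a.
  have [_ wv] := branch_exit va ba wa bw; subst w.
  have [a' l' na'] := missed v a l.
  have aa' : a = a'.
    apply/eqP; apply: contraT => aa'; case/negP: w_two.
    by apply/existsP; exists a; apply/existsP; exists a'; rewrite l l'.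
  subst a'; have [vD _] := forced_branch_entry va na' BD bD ba.
  by rewrite vD in wD.
(* Otherwise [b] has a missed leg. Its root [a'] is white, since all neighbours of [b] would else be
   black; so [w] is [a']. *)
have := IH b bD; rewrite (negbTE b_out) => /existsP[a /existsP[_ /and3P[l _ _]]].
have [a' l' na'] := missed b a l; have [_ ba' _] := legP _ _ l'.
have [a'D|a'D] := boolP (a' \in D).
  have [_ /(_ w bw)] := forced_branch_entry ba' na' BD a'D (branch_adj ba').
  by rewrite (negbTE wD).
case/negP: w_out; apply/in_legP; exists b, a'; split=> //.
by rewrite -(uniq_w a') // branch_adj.
Qed.

(** * Sufficiency of the conditions *)

(** Let [x] be a white vertex farthest from [v]. It is not the leaf, so it has a neighbour beyond
    it, which is black and has [x] as its only white neighbour. *)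
Lemma leg_blackens (C : {set T}) v a u : leg v a -> deg e u = 1 ->
  u \in branch v a -> u \in C ->
  (forall b w, b \in C -> e b w -> w \notin C ->
     exists x, [/\ e b x, x \notin C & x != w]) ->
  v |: branch v a \subset C.
Proof.
move=> l du ua uC stalled; have [mv va free] := legP _ _ l.
apply/subsetP => x0 x0a; apply: contraT => x0C.
pose P := [pred x | (x \in v |: branch v a) && (x \notin C)].
have Px0 : P x0 by rewrite /= x0a.
case: (arg_maxnP (d v) Px0) => x /= /andP[xa xC] xmax.
have black y : y \in branch v a -> d v x < d v y -> y \in C.
  move=> ya lt; apply: contraT => yC; have := xmax y.
  by rewrite /= in_setU1 ya yC orbT => /(_ isT); nat_lia.
have [c [xc ca dc]] : exists c, [/\ e x c, c \in branch v a & d v c = (d v x).+1].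
  have {xa} := xa; rewrite in_setU1 => /orP[/eqP xv|xa].
    by exists a; rewrite xv branch_adj // dist_refl dist_adj.
  have xv : x != v by rewrite eq_sym (branch_neq xa).
  have [f xf vf] := branch_exists xv.
  case: (pickP [pred c | e x c && (c != f)]) => [c /andP[xc cf]|none].
    have vc : v \notin branch x c.
      by apply: contra cf => vc; rewrite (branch_uniq xc xf vc vf).
    have [ca dc] := beyond_dist va xa xc vc (branch_adj xc).
    by exists c; rewrite dc (dist_adj xc) addn1.
  have dx : deg e x = 1.
    apply/eqP/cards1P; exists f; apply/setP => y; rewrite !inE.
    by have /= := none y; case: eqVneq => [->|_]; rewrite ?xf ?andbT.
  by rewrite (leg_leaf_uniq l xa ua dx du) uC in xC.
have cC : c \in C by apply: black => //; nat_lia.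
have cx : e c x by rewrite e_sym.
have [y [cy yC yx]] := stalled c x cC cx xC; case/negP: yC.
have vx : v \in branch c x by rewrite inE ![d _ v]dist_sym dc.
have vy : v \notin branch c y.
  by apply: contra yx => vy; rewrite (branch_uniq cy cx vy vx).
have [ya dy] := beyond_dist va ca cy vy (branch_adj cy).
by apply: black => //; nat_lia.
Qed.

Lemma leg_toward v a x y : leg v a -> x \in branch v a -> e x y ->
  v \in branch x y -> y = v \/ y \in branch v a.
Proof.
case/legP => _ va _ xa xy vy; have [|ya] := boolP (y \in branch v a); first by right.
by left; have [] := branch_exit va xa ya xy.
Qed.

(* [B] leaves out the leaf of at most one leg per major vertex; stalling is
   impossible because every major vertex is reached from some leg, and then each
   of them has at most one white neighbour. *)
Lemma zero_forcing_leaves (B : {set T}) (c : T -> T) :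
  (forall z, in_leg z || major e z) ->
  (forall v, major e v -> exists2 a, leg v a & a != c v) ->
  (forall v a, leg v a -> a != c v ->
     exists u, [/\ u \in B, deg e u = 1 & u \in branch v a]) ->
  zero_forcing e B.
Proof.
move=> cover two leaves; apply: zero_forcing_of_stalled => C BC stalled.
have black v a : leg v a -> a != c v -> v |: branch v a \subset C.
  move=> l ac; have [u [uB du ua]] := leaves v a l ac.
  exact: leg_blackens l du ua (subsetP BC u uB) stalled.
have majorC v : major e v -> v \in C.
  by move=> /two[a l ac]; apply: (subsetP (black v a l ac)); rewrite setU11.
apply/eqP; rewrite eqEsubset subsetT /=; apply/subsetP => x0 _; apply: contraT => x0C.
have /orP[/in_legP[v [a [l x0a]]]|/majorC] := cover x0; last by rewrite (negbTE x0C).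
have [mv va free] := legP _ _ l.
pose P := [pred x | (x \in branch v a) && (x \notin C)].
have Px0 : P x0 by rewrite /= x0a.
case: (arg_minnP (d v) Px0) => x /= /andP[xa xC] xmin.
have xv : x != v by rewrite eq_sym (branch_neq xa).
have [y xy vy] := branch_exists xv.
have yC : y \in C.
  have [->|ya] := leg_toward l xa xy vy; first exact: majorC.
  apply: contraT => yC; have := xmin y; rewrite ya yC => /(_ isT).
  by move: vy; rewrite inE ![d _ v]dist_sym; nat_lia.
have yx : e y x by rewrite e_sym.
have [t [yt tC tx]] := stalled y x yC yx xC.
(* If [y] is the centre, [x] and [t] are both roots of its one exceptional leg. If not, [x], [t] and
   the black [z] make [y] major inside a leg. *)
case: (leg_toward l xa xy vy) => [yv|ya].
  subst y; have ax : a = x by apply: branch_uniq va yx xa (branch_adj yx).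
  have /orP[/in_legP[w [b [l' tb]]]|/majorC] := cover t; last by rewrite (negbTE tC).
  have [_ wb _] := legP _ _ l'; rewrite e_sym in yt.
  have [tb' vw] := branch_exit wb tb (leg_majorN l' mv) yt; subst w b.
  have at_c r : leg v r -> r \notin C -> r = c v.
    move=> lr rC; apply/eqP; apply: contraT => /(black v r lr)/subsetP sub.
    have [_ vr _] := legP _ _ lr.
    by rewrite sub // in_setU1 branch_adj ?orbT in rC.
  by rewrite (at_c t) // -(at_c x) ?eqxx // -ax in tx.
have yv : y != v by rewrite eq_sym (branch_neq ya).
have [z yz vz] := branch_exists yv.
have zC : z \in C.
  have [->|za] := leg_toward l ya yz vz; first exact: majorC.
  apply: contraT => zC; have := xmin z; rewrite za zC => /(_ isT).
  by move: vy vz; rewrite !inE ![d _ v]dist_sym; nat_lia.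
have := free y ya; rewrite (major_of_nbrs yx yt yz) //.
- by rewrite eq_sym.
- by apply: contraNneq xC => ->.
- by apply: contraNneq tC => ->.
Qed.

Lemma zero_forcing_number_le_metric_dim : (exists v, major e v) ->
  (forall z, in_leg z || major e z) ->
  (forall v, major e v -> exists a b, [/\ leg v a, leg v b & a != b]) ->
  zero_forcing_number e <= metric_dim e.
Proof.
move=> has_major cover two; have [W resW <-] := metric_dim_ex.
(* The default [v] is not adjacent to itself, so it excludes no leg when [W] meets them all. *)
pose c v := odflt v [pick a | leg v a && ~~ hits W v a].
pose leaf_of p := odflt p.1 [pick u | (deg e u == 1) && (u \in branch p.1 p.2)].
pose Q := [set p : T * T | leg p.1 p.2 & p.2 != c p.1].
have hitQ v a : leg v a -> a != c v -> hits W v a.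
  move=> l; apply: contraR => na; rewrite /c; case: pickP => [b /andP[lb nb]|/(_ a)] /=.
    have [[_ va _] [_ vb _]] := (legP _ _ l, legP _ _ lb).
    by rewrite (resolving_hits resW va vb na nb).
  by rewrite l na.
have leaf_ofP v a :
    leg v a -> deg e (leaf_of (v, a)) = 1 /\ leaf_of (v, a) \in branch v a.
  move=> /legP[_ va _]; rewrite /leaf_of /=; case: pickP => [u /andP[/eqP]|] //= none.
  by have [u du ua] := branch_has_leaf va; have := none u; rewrite du ua.
apply: (@leq_trans #|leaf_of @: Q|).
  apply: zero_forcing_number_min; apply: (zero_forcing_leaves (c := c)) => //.
    move=> v /two[a [b [la lb ab]]]; have [ac|ac] := eqVneq a (c v); last by exists a.
    by exists b; rewrite // -ac eq_sym.
  move=> v a l ac; have [du ua] := leaf_ofP v a l; exists (leaf_of (v, a)); split=> //.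
  by apply: imset_f; rewrite inE l.
apply: leq_trans (leq_imset_card _ _) _.
(* Legs are disjoint, so choosing an element of [W] in each leg of [Q] is injective. *)
pose f p := odflt p.1 [pick w | (w \in W) && (w \in branch p.1 p.2)].
have fP p : p \in Q -> f p \in W /\ f p \in branch p.1 p.2.
  rewrite inE => /andP[l pc]; have /exists_inP[w wW wp] := hitQ _ _ l pc.
  by rewrite /f; case: pickP => [u /andP[]|/(_ w)] //=; rewrite wW wp.
rewrite -(card_in_imset (f := f)) => [|[v a] [v' a'] pQ pQ' eqf].
  by apply/subset_leq_card/subsetP => _ /imsetP[p /fP[pW _] ->].
have [[_ fa] [_ fa']] := (fP _ pQ, fP _ pQ'); rewrite -eqf in fa'.
move: pQ pQ'; rewrite !inE => /andP[/= l _] /andP[/= l' _].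
by have [-> ->] := leg_inj l l' fa fa'.
Qed.

(** * Paths *)

(** Both numbers are 1: an end-vertex forces the path, and the empty set resolves no pair. On a
    single vertex the empty set is resolving but not forcing. *)
Lemma path_zero_forcing_number : 2 <= #|T| -> (forall v, ~~ major e v) ->
  metric_dim e = zero_forcing_number e.
Proof.
move=> /card_gt1P[x0 [y0 [_ _ xy0]]] no_major; apply/eqP.
rewrite eqn_leq metric_dim_le_zero_forcing_number /=.
apply: (@leq_trans 1); last first.
  have [W resW <-] := metric_dim_ex; rewrite card_gt0; apply: contraTneq resW => ->.
  apply/forallPn; exists x0; apply/forallPn; exists y0; rewrite negb_imply xy0 /=.
  by apply/exists_inP => -[w]; rewrite inE.
have [a xa _] := branch_exists xy0; have [u du _] := branch_has_leaf xa.
rewrite -(cards1 u); apply/zero_forcing_number_min/zero_forcing_of_stalled.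
move=> C uC stalled; apply/eqP; rewrite eqEsubset subsetT /=; apply/subsetP => t0 _.
rewrite sub1set in uC; apply: contraT => t0C.
case: (arg_minnP (d u) (t0C : [pred t | t \notin C] t0)) => x /= xC xmin.
have black y : d y u < d x u -> y \in C.
  by move=> lt; apply: contraT => /xmin; move: lt; rewrite ![d _ u]dist_sym; nat_lia.
have xu : x != u by apply: contraNneq xC => ->.
have [y xy dy] := toward xu; have yC : y \in C by apply: black; nat_lia.
have yx : e y x by rewrite e_sym.
have [t [yt tC tx]] := stalled y x yC yx xC.
have [yu|yu] := eqVneq y u.
  by subst y; rewrite (leaf_nbr_uniq du yt yx) eqxx in tx.
have [z yz dz] := toward yu; have zC : z \in C by apply: black; nat_lia.
case/negP: (no_major y); apply: (major_of_nbrs yx yt yz).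
- by rewrite eq_sym.
- by apply: contraNneq xC => ->.
- by apply: contraNneq tC => ->.
Qed.

End TreeMetric.

Theorem theorem2p12 (T : finType) (e : rel T) (tree_e : is_tree e)
    (order_ge2 : 2 <= #|T|) :
  metric_dim e = zero_forcing_number e <->
  (forall v : T, ~ interior_deg2 e v) /\
  (forall v : T, major e v -> 2 <= ter e v).
Proof.
case: (pickP (major e)) => [v0 mv0|no_major]; last first.
  split=> _; last by apply: path_zero_forcing_number => // v; rewrite no_major.
  split=> v; last by rewrite no_major.
  by case=> _ [u /existsP[w /and3P[_]]]; rewrite no_major.
have has_major : exists v, major e v by exists v0.
split=> [dimZ|[no_interior ter2]].
  have [B zfB cardB] := zero_forcing_number_ex e.
  have minB (W : {set T}) : resolving e W -> #|B| <= #|W|.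
    by rewrite cardB -dimZ; apply: metric_dim_min.
  have legs z := leg_or_two_legs tree_e z has_major zfB minB.
  split=> v.
    move=> int; have [dv ex_ter _] := int.
    case: (legs v) => [|[a [_ [/legP[+ _ _] _ _]]]]; last by rewrite /major dv.
    by move/(interior_deg2P tree_e ex_ter dv).
  move=> mv; apply/(ter_ge2P tree_e); case: (legs v) => //.
  by case/in_legP => w [a [l va]]; rewrite (negbTE (leg_majorN l mv)) in va.
apply/eqP; rewrite eqn_leq metric_dim_le_zero_forcing_number //=.
apply: zero_forcing_number_le_metric_dim => // [z|v /ter2/(ter_ge2P tree_e)//].
have [mz|mz] := boolP (major e z); first by rewrite orbT.
have ex_ter : exists u, terminal e u.
  have /card_gt1P[u [u' []]] := ter2 v0 mv0; rewrite inE => tu _ _.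
  by exists u; apply/existsP; exists v0.
(* A non-major vertex then has degree one or two: a leaf is in a leg, and so is a degree-two vertex
   that is not interior. *)
have : 0 < deg e z.
  have /card_gt1P[x [y [_ _ xy]]] := order_ge2.
  have [w zw] : exists w, z != w.
    by have [zx|zx] := eqVneq z x; [exists y; rewrite zx | exists x].
  by have [a za _] := branch_exists tree_e zw; apply/card_gt0P; exists a; rewrite inE.
move: mz; rewrite /major -leqNgt orbF.
case dz: (deg e z) => [|[|[|]]] // _ _.
  by apply/in_legP; apply: leaf_in_leg.
by apply/(interior_deg2P tree_e) => //; apply: no_interior.
Qed.
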